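(* Let $\Omega\subset\mathbb{R}^n$ be a proper convex domain equipped with its Funk metric $F_\Omega$, let $x\in\Omega$ and let $\rho>0$. Then: (1) The forward open ball $B^+(x,\rho)$ is the image of $\Omega$ by the Euclidean homothety of center $x$ and dilation factor $1-e^{-\rho}$. (2) The backward open ball $B^-(x,\rho)$ is the intersection of $\Omega$ with the image of $\Omega$ by the Euclidean homothety of center $x$ and dilation factor $e^{\rho}-1$, followed by the Euclidean central symmetry centered at $x$.
   Context: A proper convex domain in $\mathbb{R}^n$ is a non-empty open convex subset $\Omega\neq\mathbb{R}^n$. View $\mathbb{R}^n$ as an affine chart of $\mathbb{RP}^n$ with hyperplane at infinity $H_\infty=\mathbb{RP}^n\setminus\mathbb{R}^n$. For $x\ne y$ in $\Omega$ let $R(x,y)=\{x+t(y-x): t\ge 0\}$. Define $a_\Omega(x,y)$ to be the unique point of $R(x,y)\cap\partial\Omega$ if $R(x,y)\not\subset\Omega$, and the point at infinity of $R(x,y)$ (an element of $H_\infty$) if $R(x,y)\subset\Omega$. The Funk metric is $F_\Omega(x,x)=0$ and, for $x\neq y$ and $a=a_\Omega(x,y)$, $F_\Omega(x,y)=\log\frac{|x-a|}{|y-a|}$ if $a\notin H_\infty$ and $F_\Omega(x,y)=0$ if $a\in H_\infty$. For $\rho>0$, the forward and backward open balls are $B^+(x,\rho)=\{y\in\Omega: F_\Omega(x,y)<\rho\}$ and $B^-(x,\rho)=\{y\in\Omega: F_\Omega(y,x)<\rho\}$. *)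

(* Defs.v *)
From mathcomp Require Import all_boot all_order all_algebra.
From mathcomp Require Import all_classical all_reals all_analysis.

Set Implicit Arguments.
Unset Strict Implicit.
Unset Printing Implicit Defensive.

Import Order.TTheory GRing.Theory Num.Theory.
Import numFieldNormedType.Exports.

Local Open Scope classical_set_scope.
Local Open Scope ring_scope.

(* The library norm `|v| on 'rV[R]_n is the sup norm, which induces the usual
   topology; lengths are measured with the Euclidean norm below. *)
Definition enorm (R : realType) (n : nat) (v : 'rV[R]_n) : R :=
  Num.sqrt (\sum_(i < n) v ord0 i ^+ 2).

Definition proper_convex_domain (R : realType) (n : nat)
    (Omega : set 'rV[R]_n) : Prop :=
  [/\ Omega !=set0, open Omega, convex_set Omega & Omega <> setT].

Definition boundary (T : topologicalType) (A : set T) : set T :=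
  closure A `\` interior A.

Definition ray (R : realType) (n : nat) (x y : 'rV[R]_n) : set 'rV[R]_n :=
  [set x + t *: (y - x) | t in [set t : R | 0 <= t]].

(* Points of RP^n are the lines through the origin of R^(1+n); the affine chart
   sends p to the line spanned by (1, p). *)
Definition proj_space (R : realType) (n : nat) : set {vspace 'rV[R]_(1 + n)} :=
  [set L | \dim L = 1%N].

Definition chart (R : realType) (n : nat) (p : 'rV[R]_n) :
    {vspace 'rV[R]_(1 + n)} :=
  <[row_mx 1%:M p]>%VS.

Definition hyperplane_at_infinity (R : realType) (n : nat) :
    set {vspace 'rV[R]_(1 + n)} :=
  @proj_space R n `\` range (@chart R n).

Definition affine_coord (R : realType) (n : nat) (L : {vspace 'rV[R]_(1 + n)}) :
    'rV[R]_n :=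
  get [set p | chart p = L].

(* For x != y: the limit in RP^n of chart (x + t *: (y - x)) as t --> +oo. *)
Definition ray_infinity (R : realType) (n : nat) (x y : 'rV[R]_n) :
    {vspace 'rV[R]_(1 + n)} :=
  <[row_mx (0 : 'M[R]_1) (y - x)]>%VS.

(* Only meaningful for x != y, both in Omega. *)
Definition exit_point (R : realType) (n : nat) (Omega : set 'rV[R]_n)
    (x y : 'rV[R]_n) : {vspace 'rV[R]_(1 + n)} :=
  if `[< ray x y `<=` Omega >] then ray_infinity x y
  else chart (get (ray x y `&` boundary Omega)).

Definition funk (R : realType) (n : nat) (Omega : set 'rV[R]_n)
    (x y : 'rV[R]_n) : R :=
  if x == y then 0 else
  let a := exit_point Omega x y in
  if a \in @hyperplane_at_infinity R n then 0
  else let p := affine_coord a in ln (enorm (x - p) / enorm (y - p)).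

Definition forward_ball (R : realType) (n : nat) (Omega : set 'rV[R]_n)
    (x : 'rV[R]_n) (rho : R) : set 'rV[R]_n :=
  [set y | Omega y /\ funk Omega x y < rho].

Definition backward_ball (R : realType) (n : nat) (Omega : set 'rV[R]_n)
    (x : 'rV[R]_n) (rho : R) : set 'rV[R]_n :=
  [set y | Omega y /\ funk Omega y x < rho].

Definition homothety (R : realType) (n : nat) (c : 'rV[R]_n) (k : R)
    (z : 'rV[R]_n) : 'rV[R]_n :=
  c + k *: (z - c).

Definition central_symmetry (R : realType) (n : nat) (c z : 'rV[R]_n) :
    'rV[R]_n :=
  c - (z - c).

(* Main.v *)
Require Import Defs.
From mathcomp Require Import all_boot all_order all_algebra.
From mathcomp Require Import all_classical all_reals all_analysis.
From mathcomp Require Import ring lra.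

Import Order.TTheory GRing.Theory Num.Theory.
Import numFieldNormedType.Exports.

Local Open Scope classical_set_scope.
Local Open Scope ring_scope.

(** Both parts are restatements of one criterion, [funk_lt]: for x, y in an open
    convex set Omega and tau := 1 / (1 - e^-rho),

      F(x, y) < rho  if and only if  x + tau (y - x) lies in Omega.

    Indeed, if the ray from x through y leaves Omega, then it does so at a
    single time s > 1: the times t >= 0 with x + t (y - x) in Omega are exactly
    those with t < s ([exit_time]), and x + s (y - x) is the only point of the
    ray on the boundary ([get_ray_boundary]).  Hence F(x, y) = ln (s / (s - 1))
    ([funk_exit_time]), which is below rho if and only if tau < s, that is, if
    and only if the point at time tau is still in Omega.  If the ray stays in
    Omega, both sides of the criterion hold, and both hold when x = y too.

    For the forward ball, x + tau (y - x) is the preimage of y under the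
    homothety of centre x and factor 1 - e^-rho = 1 / tau; y itself lies in
    Omega by convexity, since this factor is at most 1.  For the backward ball
    the roles of x and y are exchanged, and
    y + tau (x - y) = x - (tau - 1) (y - x) is the preimage of y under the
    homothety of factor 1 / (tau - 1) = e^rho - 1 followed by the central
    symmetry. *)

(** * Convex and open sets along a ray *)

Section Rays.
Set Implicit Arguments.
Unset Strict Implicit.
Context {R : realType} {n : nat}.
Implicit Types (A : set 'rV[R]_n) (x y d p q v : 'rV[R]_n).

Lemma convex_setP A x y k : convex_set A -> A x -> A y ->
  0 <= k <= 1 -> A (k *: x + (1 - k) *: y).
Proof.
move=> cA Ax Ay /andP[k0 k1].
(* The library states convexity with weights in the interval type {i01 R}. *)
have k01 : Itv.spec (@Itv.num_sem R) (Itv.Real `[0%Z, 1%Z]) k.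
  by rewrite /Itv.spec/= /Itv.num_sem/= in_itv/= k0 k1 ger0_real.
have := cA x y (Itv.mk k01); rewrite !inE; exact.
Qed.

Lemma convex_ray_le A x d s t : convex_set A -> A x -> A (x + s *: d) ->
  0 <= t <= s -> A (x + t *: d).
Proof.
move=> cA Ax As /andP[t0 ts].
have [s0|s0] := eqVneq s 0.
  by have -> : t = 0 by [lra]; rewrite scale0r addr0.
have sgt0 : 0 < s by rewrite lt_neqAle eq_sym s0 (le_trans t0).
have -> : x + t *: d = (t / s) *: (x + s *: d) + (1 - t / s) *: x.
  by apply/rowP => i; rewrite !mxE; field.
apply: convex_setP => //.
by rewrite divr_ge0 ?(ltW sgt0)//= ler_pdivrMr ?mul1r.
Qed.

Lemma continuous_ray x d : continuous (fun t : R => x + t *: d).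
Proof. by move=> t; apply: cvgD; [exact: cvg_cst|exact: scalel_continuous]. Qed.

Lemma open_ray_gt A x d t : open A -> A (x + t *: d) ->
  exists2 u, t < u & A (x + u *: d).
Proof.
move=> oA At.
have /nbhs_ballP[e /= e0 eA] : nbhs t ((fun u => x + u *: d) @^-1` A).
  by apply: (@continuous_ray x d t); exact: open_nbhs_nbhs.
exists (t + e / 2); first by lra.
apply: eA; rewrite /ball/= opprD addrA subrr sub0r normrN gtr0_norm; lra.
Qed.

(** A point strictly between a point of an open convex set and a point of its
    closure belongs to the set: the dilation centred at the intermediate point
    that takes q to x is continuous, so it takes some point z of A near q to a
    point of A, and the intermediate point lies between z and its image. *)
Lemma convex_segment_closure A x q m : convex_set A -> open A -> A x ->
  closure A q -> 0 < m < 1 -> A (m *: q + (1 - m) *: x).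
Proof.
move=> cA oA Ax clq /andP[m0 m1].
pose p := m *: q + (1 - m) *: x.
pose f z := (1 - m)^-1 *: p + (- m / (1 - m)) *: z.
have m1' : 1 - m != 0 by rewrite gt_eqF// subr_gt0.
have fq : f q = x by apply/rowP => i; rewrite !mxE; field.
have cf : f z @[z --> q] --> f q.
  exact: (cvgD (cvg_cst _) (@scaler_continuous R _ (- m / (1 - m)) q)).
have /clq[z [Az /= Afz]] : nbhs q (f @^-1` A).
  by apply: cf; rewrite fq; exact: open_nbhs_nbhs.
rewrite -/p.
have -> : p = m *: z + (1 - m) *: f z.
  by apply/rowP => i; rewrite /f !mxE; field.
by apply: convex_setP; rewrite // !ltW.
Qed.

(** The exit time s of the ray x + t d: by convexity the times in A form an
    interval starting at 0, and it is half-open because A is open. *)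
Lemma exit_time A x d : convex_set A -> open A -> A x -> A (x + d) ->
  ~ (forall t, 0 <= t -> A (x + t *: d)) ->
  exists2 s, 1 < s & forall t, 0 <= t -> A (x + t *: d) <-> t < s.
Proof.
move=> cA oA Ax Ad /existsNP[t0 /not_implyP[t0ge0 nAt0]].
pose T := [set t | 0 <= t /\ A (x + t *: d)].
have T1 : T 1 by split => //; rewrite scale1r.
have supT : has_sup T.
  split; first by exists 1.
  exists t0 => t [t_ge0 At]; rewrite leNgt; apply/negP => lt_t0.
  by apply: nAt0; apply: (convex_ray_le cA Ax At); rewrite t0ge0 ltW.
have key t : 0 <= t -> A (x + t *: d) <-> t < sup T.
  move=> t_ge0; split=> [At|tT]; last first.
    have [u [u0 Au] tu] : exists2 u, T u & t < u.
      by apply: sup_gt => //; exists 1.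
    by apply: (convex_ray_le cA Ax Au); rewrite t_ge0 ltW.
  have [u tu Au] := open_ray_gt oA At.
  apply: (lt_le_trans tu); apply: sup_upper_bound => //; split => //.
  by apply: le_trans t_ge0 (ltW tu).
exists (sup T) => //.
by apply/key => //; rewrite scale1r.
Qed.

Lemma boundary_open A : open A -> boundary A = closure A `\` A.
Proof. by move=> /interior_id ?; rewrite /boundary; congr (_ `\` _). Qed.

Lemma get_ray_boundary A x y s : convex_set A -> open A -> A x -> 0 < s ->
  (forall t, 0 <= t -> A (x + t *: (y - x)) <-> t < s) ->
  get (ray x y `&` boundary A) = x + s *: (y - x).
Proof.
move=> cA oA Ax s0 sP; rewrite boundary_open//.
apply: get_unique.
  split; first by exists s => //=; exact: ltW.
  split; last by move/sP; rewrite ltxx => /(_ (ltW s0)).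
  move=> B /(@continuous_ray x (y - x) s)/nbhs_ballP[e /= e0 eB].
  (* A time before s, close enough to s, gives a point of A in B. *)
  pose t := Num.max 0 (s - e / 2).
  have [t_ge0 ts st] : [/\ 0 <= t, t < s & s - t < e].
    by rewrite /t; case: (ltP 0 (s - e / 2)); split; lra.
  exists (x + t *: (y - x)); split; first exact/sP.
  by apply: eB; rewrite /ball/= gtr0_norm; lra.
move=> _ [[t /= t_ge0 <-]] [clt nAt].
have st : s <= t by rewrite leNgt; apply/negP => /(sP _ t_ge0).
have [->//|nst] := eqVneq t s.
have lt_st : s < t by rewrite lt_neqAle eq_sym nst.
have t0 : 0 < t by exact: lt_trans lt_st.
have : A ((s / t) *: (x + t *: (y - x)) + (1 - s / t) *: x).
  apply: convex_segment_closure => //.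
  by rewrite divr_gt0//= ltr_pdivrMr// mul1r.
have -> : (s / t) *: (x + t *: (y - x)) + (1 - s / t) *: x = x + s *: (y - x).
  by apply/rowP => i; rewrite !mxE; field; rewrite gt_eqF.
by move/sP; rewrite ltxx => /(_ (ltW s0)).
Qed.

(** * The Euclidean norm and the projective completion *)

Lemma enormZ (k : R) v : enorm (k *: v) = `|k| * enorm v.
Proof.
rewrite /enorm.
under eq_bigr do rewrite mxE exprMn.
by rewrite -mulr_sumr sqrtrM ?sqr_ge0// sqrtr_sqr.
Qed.

Lemma enorm_gt0 v : v != 0 -> 0 < enorm v.
Proof.
move=> v0; rewrite sqrtr_gt0 lt_neqAle sumr_ge0 ?andbT; last first.
  by move=> i _; exact: sqr_ge0.
apply: contra_neq v0 => /esym s0; apply/rowP => i; rewrite mxE.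
apply/eqP; rewrite -sqrf_eq0; apply/eqP.
by apply: (psumr_eq0P _ s0) => // j _; exact: sqr_ge0.
Qed.

(** The first coordinate of the spanning vector row_mx 1 p fixes the scalar. *)
Lemma chart_inj : injective (@chart R n).
Proof.
move=> p q pq.
have : row_mx 1%:M p \in chart q by rewrite -pq memv_line.
case/vlineP => k; rewrite scale_row_mx => /eq_row_mx[k1 ->].
move/matrixP/(_ ord0 ord0): k1; rewrite !mxE/= mulr1 => <-.
by rewrite scale1r.
Qed.

Lemma affine_coord_chart p : affine_coord (chart p) = p.
Proof. by apply: get_unique => // q /chart_inj. Qed.

Lemma chart_notin_infinity p :
  (chart p \in @hyperplane_at_infinity R n) = false.
Proof. by apply/negbTE; rewrite notin_setE => -[_]; apply; exists p. Qed.

Lemma ray_infinity_in_infinity x y : x != y ->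
  ray_infinity x y \in @hyperplane_at_infinity R n.
Proof.
move=> xy; rewrite inE; split.
  rewrite /proj_space/= /ray_infinity dim_vline.
  suff -> : row_mx (0 : 'M[R]_1) (y - x) != 0 by [].
  apply: contra_neq xy; rewrite -row_mx0 => /eq_row_mx[_ /eqP].
  by rewrite subr_eq0 => /eqP.
case=> p _ pE.
have : row_mx 1%:M p \in ray_infinity x y by rewrite -pE memv_line.
case/vlineP => k; rewrite scale_row_mx => /eq_row_mx[/matrixP/(_ ord0 ord0)].
by rewrite !mxE mulr0 => /eqP; rewrite oner_eq0.
Qed.

(** * The Funk metric in terms of exit times *)

Lemma funk_exit_time A x y s : convex_set A -> open A -> A x -> x != y ->
  1 < s -> (forall t, 0 <= t -> A (x + t *: (y - x)) <-> t < s) ->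
  funk A x y = ln (s / (s - 1)).
Proof.
move=> cA oA Ax xy s1 sP.
have s0 : 0 < s by lra.
rewrite /funk (negbTE xy) /exit_point asboolF; last first.
  move=> /(_ (x + s *: (y - x))) As.
  have /(sP s (ltW s0)) : A (x + s *: (y - x)).
    by apply: As; exists s => //=; exact: ltW.
  by rewrite ltxx.
rewrite (get_ray_boundary cA oA Ax s0 sP) chart_notin_infinity.
rewrite affine_coord_chart; congr (ln _).
have -> : x - (x + s *: (y - x)) = (- s) *: (y - x).
  by apply/rowP => i; rewrite !mxE; ring.
have -> : y - (x + s *: (y - x)) = (1 - s) *: (y - x).
  by apply/rowP => i; rewrite !mxE; ring.
rewrite !enormZ normrN (gtr0_norm s0) distrC gtr0_norm ?subr_gt0//.
have e0 : enorm (y - x) != 0.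
  by rewrite gt_eqF// enorm_gt0// subr_eq0 eq_sym.
by field; rewrite e0 subr_eq0 gt_eqF.
Qed.

Lemma funk_ray_subset A x y : ray x y `<=` A -> funk A x y = 0.
Proof.
move=> xyA; rewrite /funk; case: ifPn => // xy.
by rewrite /exit_point asboolT// ray_infinity_in_infinity.
Qed.

(** The ball criterion: y is within Funk distance rho of x exactly when the
    point of the ray at time 1 / (1 - e^-rho) is still in A. *)
Lemma funk_lt A x y rho : convex_set A -> open A -> A x -> A y -> 0 < rho ->
  funk A x y < rho <-> A (x + (1 - expR (- rho))^-1 *: (y - x)).
Proof.
move=> cA oA Ax Ay rho0.
have e1 : expR (- rho) < 1 by rewrite expR_lt1 oppr_lt0.
have e0 := expR_gt0 (- rho).
have tau0 : 0 <= (1 - expR (- rho))^-1 by rewrite invr_ge0; lra.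
have [<-|xy] := eqVneq x y.
  by rewrite subrr scaler0 addr0 /funk eqxx.
(* If the ray never leaves A, the Funk distance is 0 and both sides hold. *)
have [xyA|nxyA] := pselect (forall t, 0 <= t -> A (x + t *: (y - x))).
  rewrite funk_ray_subset; last by move=> _ [t /= t0 <-]; exact: xyA.
  by split => // _; exact: xyA.
have Ad : A (x + (y - x)) by rewrite addrC subrK.
have [s s1 sP] := exit_time cA oA Ax Ad nxyA.
rewrite (funk_exit_time cA oA Ax xy s1 sP).
apply: iff_trans (iff_sym (sP _ tau0)).
have s0 : 0 < s by lra.
have s10 : 0 < s - 1 by lra.
have -> : (ln (s / (s - 1)) < rho) = (s / (s - 1) < expR rho).
  by rewrite -ltr_expR lnK// posrE divr_gt0.
(* Both s / (s - 1) < 1 / e^-rho and 1 / (1 - e^-rho) < s are cleared of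
   denominators; each then amounts to e^-rho * s < s - 1. *)
rewrite -[rho in expR rho]opprK expRN ltr_pdivrMr// mulrC ltr_pdivlMr//.
rewrite invf_plt ?posrE//; last by lra.
have -> : (s^-1 < 1 - expR (- rho)) = (1 < (1 - expR (- rho)) * s).
  by rewrite -div1r ltr_pdivrMr.
by split=> h; nra.
Qed.

End Rays.

(** * Forward and backward balls *)

Theorem proposition5p1 (R : realType) (n : nat) (Omega : set 'rV[R]_n)
    (x : 'rV[R]_n) (rho : R) (hOmega : proper_convex_domain Omega)
    (hx : Omega x) (hrho : 0 < rho) :
  forward_ball Omega x rho = homothety x (1 - expR (- rho)) @` Omega /\
  backward_ball Omega x rho =
    Omega `&` (central_symmetry x @` (homothety x (expR rho - 1) @` Omega)).
Proof.
case: hOmega => _ oO cO _.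
have e1 : expR (- rho) < 1 by rewrite expR_lt1 oppr_lt0.
have e0 := expR_gt0 (- rho).
have k0 : 1 - expR (- rho) != 0 by rewrite subr_eq0 gt_eqF.
split; apply/seteqP; split => y.
- move=> [Oy /(funk_lt cO oO hx Oy hrho) Oz].
  exists (x + (1 - expR (- rho))^-1 *: (y - x)) => //.
  by apply/rowP => i; rewrite !mxE; field.
- move=> [z Oz <-]; rewrite /forward_ball/=.
  have Oy : Omega (homothety x (1 - expR (- rho)) z).
    apply: (@convex_ray_le _ _ _ _ _ 1) => //; last by lra.
    by rewrite scale1r addrC subrK.
  split=> //; apply/(funk_lt cO oO hx Oy hrho).
  suff -> : x + (1 - expR (- rho))^-1 *: (homothety x (1 - expR (- rho)) z - x)
            = z by [].
  by apply/rowP => i; rewrite !mxE; field.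
- move=> [Oy /(funk_lt cO oO Oy hx hrho) Oz]; split => //.
  set z := (X in Omega X) in Oz.
  exists (homothety x (expR rho - 1) z); first by exists z.
  apply/rowP => i; rewrite !mxE -[rho in expR rho]opprK (expRN (- rho)).
  by field; rewrite k0 gt_eqF.
- move=> [Oy [_ [z Oz <-] yE]]; split => //.
  apply/(funk_lt cO oO Oy hx hrho).
  suff -> : y + (1 - expR (- rho))^-1 *: (x - y) = z by [].
  rewrite -yE; apply/rowP => i.
  rewrite !mxE -[rho in expR rho]opprK (expRN (- rho)).
  by field; rewrite k0 gt_eqF.
Qed.
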